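(* Chacon's automorphism $T$ is not $\alpha$-weakly mixing for any $0<\alpha<1$; that is, for no $\alpha\in(0,1)$ does there exist a sequence of integers $(k_j)$ such that $\hat T^{k_j}$ converges weakly to $\alpha\Theta+(1-\alpha)\mathrm{Id}$.
   Context: Chacon's (classical) automorphism $T$ of a probability space $(X,\mathscr A,\mu)$ is the rank-one transformation built by cutting and stacking. Tower $0$ is a single interval (height $h_0=1$) of measure $2/3$. For $n\ge1$, Tower $n-1$ (of height $h_{n-1}$) is cut into 3 sub-columns of equal width, one spacer (a new interval of the same width) is inserted above the middle sub-column, and the three parts are stacked from left to right to give Tower $n$, of height $h_n=3h_{n-1}+1$. $X$ is the union of all the towers (total measure $1$), and $T$ maps each level of each tower, other than its top level, by translation onto the level above it. $T$ is an invertible measure-preserving transformation (defined a.e.). Koopman operator: $\hat T f=f\circ T$ on $L^2(X,\mu)$. $\Theta f=\int f\,d\mu$ is the orthogonal projection onto constants. Weak convergence is convergence in the weak operator topology on $L^2(X,\mu)$. An automorphism $S$ is $\alpha$-weakly mixing ($0\le\alpha\le1$) if there is a sequence $(k_j)$ of integers such that $\hat S^{k_j}$ converges weakly to $\alpha\Theta+(1-\alpha)\mathrm{Id}$. *)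

(* Defs.v *)
From HB Require Import structures.
From mathcomp Require Import all_boot all_order all_algebra.
From mathcomp Require Import zify ring lra.
From mathcomp Require Import all_classical all_reals all_analysis.

Set Implicit Arguments.
Unset Strict Implicit.
Unset Printing Implicit Defensive.

Import Order.TTheory GRing.Theory Num.Theory.
Import numFieldNormedType.Exports.

Local Open Scope classical_set_scope.
Local Open Scope ring_scope.

(* L^2 is the real space, represented by functions ([f \in Lfun P 2%:E])
   rather than by a.e. classes; operators are maps on functions, and for the
   nonsingular maps considered here they are compatible with a.e. equality. *)
Section weak_mixing.
Context {d : measure_display} {X : measurableType d} {R : realType}.
Variable P : probability X R.

Definition koopman (S : X -> X) (f : X -> R) : X -> R := f \o S.

(* An automorphism is only invertible a.e., so it is given together with a map
   [S'] that is its inverse up to a null set. *)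
Definition koopman_pow (S S' : X -> X) (k : int) : (X -> R) -> (X -> R) :=
  match k with
  | Posz n => iter n (koopman S)
  | Negz n => iter n.+1 (koopman S')
  end.

Definition Theta (f : X -> R) : X -> R := cst (\int[P]_x f x).

Definition weak_cvg (A : nat -> (X -> R) -> (X -> R))
    (B : (X -> R) -> (X -> R)) : Prop :=
  forall f g : X -> R, f \in Lfun P 2%:E -> g \in Lfun P 2%:E ->
    (\int[P]_x (A j f x * g x)) @[j --> \oo] --> \int[P]_x (B f x * g x).

Definition alpha_weakly_mixing (S S' : X -> X) (alpha : R) : Prop :=
  exists k : nat -> int,
    weak_cvg (fun j => koopman_pow S S' (k j))
             (fun f => alpha \*o Theta f \+ (1 - alpha) \*o f).

End weak_mixing.

Section chacon.
Variable R : realType.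

Definition width (n : nat) : R := 2 / 3 / 3 ^+ n.

(* Left endpoints of the levels of Tower n, from bottom to top.  The levels are
   half-open intervals of length [width n]; the spacer of Tower n.+1 is put
   immediately to the right of Tower n, whose measure is
   [(size (tower n))%:R * width n]. *)
Fixpoint tower (n : nat) : seq R :=
  if n is m.+1 then
    let t := tower m in
    let w := width m.+1 in
    t ++ [seq a + w | a <- t] ++ [:: (size t)%:R * width m]
      ++ [seq a + 2 * w | a <- t]
  else [:: 0].

Lemma size_towerS n : size (tower n.+1) = (3 * size (tower n) + 1)%N.
Proof. by rewrite /= !size_cat /= !size_map; lia. Qed.

Definition level (n : nat) (a : R) : set R := `[a, a + width n[.

Definition chacon_space : set R :=
  \bigcup_n \bigcup_(a in [set a : R | a \in tower n]) level n a.

(* x lies in a level of some tower, other than its top level, and y is the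
   image of x under the translation onto the level above. *)
Definition chacon_graph (x y : R) : Prop :=
  exists n i, [/\ (i.+1 < size (tower n))%N, level n (tower n)`_i x
                & y = x - (tower n)`_i + (tower n)`_i.+1].

(* [chacon_graph] is a partial bijection, defined on the whole of
   [chacon_space] and onto [chacon_space] minus the point 0; the values chosen
   elsewhere are irrelevant since they only concern a null set. *)
Definition chacon (x : R) : R := xget x [set y | chacon_graph x y].
Definition chacon_inv (y : R) : R := xget y [set x | chacon_graph x y].

Lemma width_gt0 n : 0 < width n.
Proof. by rewrite /width !divr_gt0// exprn_gt0. Qed.

Lemma widthS n : width n = 3 * width n.+1.
Proof. by rewrite /width exprS; field; rewrite expf_neq0. Qed.

Lemma tower_measure n : (size (tower n))%:R * width n = 1 - width n / 2.
Proof.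
elim: n => [|n IH]; first by rewrite /= /width expr0; field.
rewrite size_towerS natrD natrM mulrDl mul1r.
by move: IH; rewrite (widthS n); lra.
Qed.

Lemma tower_cover n (x : R) :
  (\bigcup_(a in [set a : R | a \in tower n]) level n a) x <->
  0 <= x < (size (tower n))%:R * width n.
Proof.
have E m a y : level m a y = (a <= y < a + width m) :> Prop.
  by rewrite /level/= in_itv.
elim: n x => [|n IH] x.
  rewrite mul1r; split=> [[a /= /[!inE] /eqP->]|h]; first by rewrite E add0r.
  by exists 0; rewrite /= ?inE// E add0r.
have w0 := width_gt0 n.+1; have wS := widthS n.
have mS := tower_measure n.+1; have m := tower_measure n.
have m0 : 0 <= (size (tower n))%:R * width n.
  by rewrite mulr_ge0// ltW// width_gt0.
rewrite mS; split.
- move=> [a /=]; rewrite !mem_cat inE E => /or4P[|||] => [ta|/mapP[b tb ->]|/eqP->|/mapP[b tb ->]] h.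
  + have /IH : (\bigcup_(a in [set a : R | a \in tower n]) level n a) x.
      by exists a => //; rewrite E; lra.
    by rewrite m; lra.
  + have /IH : (\bigcup_(a in [set a : R | a \in tower n]) level n a) x.
      by exists b => //; rewrite E; lra.
    by rewrite m; lra.
  + by move: h m0; rewrite m; lra.
  + have /IH : (\bigcup_(a in [set a : R | a \in tower n]) level n a) x.
      by exists b => //; rewrite E; lra.
    by rewrite m; lra.
- move=> h; have [xt|xt] := ltP x ((size (tower n))%:R * width n); last first.
    exists ((size (tower n))%:R * width n).
      by rewrite /= !mem_cat inE eqxx !orbT.
    by rewrite E; move: xt; rewrite m; lra.
  have [|a /= ta] := (IH x).2; first by lra.
  rewrite E => xa.
  have [x1|x1] := ltP x (a + width n.+1).
    by exists a; rewrite /= ?mem_cat ?ta// E; lra.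
  have [x2|x2] := ltP x (a + 2 * width n.+1).
    exists (a + width n.+1); last by rewrite E; lra.
    by rewrite /= !mem_cat (map_f (fun a => a + width n.+1)) ?orbT.
  exists (a + 2 * width n.+1); last by rewrite E; lra.
  by rewrite /= !mem_cat in_cons (map_f (fun a => a + 2 * width n.+1)) ?orbT.
Qed.

Lemma chacon_spaceE : chacon_space = `[0, 1[%classic.
Proof.
apply/seteqP; split=> x /=; rewrite in_itv/=.
  move=> [n _ /tower_cover]; rewrite tower_measure.
  by have := width_gt0 n; lra.
move=> /andP[x0 x1].
have [n hn] : exists n, width n < 1 - x.
  have /cvgr0_norm_lt/(_ (1 - x)) : geometric (2 / 3) (3^-1 : R) @ \oo --> 0.
    by apply: cvg_geometric; rewrite ger0_norm; lra.
  case=> [|n _ /(_ n (leqnn n)) h]; first by lra.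
  exists n; move: h; rewrite /= exprVn ger0_norm// ltW//; exact: width_gt0.
exists n => //; apply/tower_cover; rewrite tower_measure.
by have := width_gt0 n; lra.
Qed.

(* Level p of Tower n is cut into levels p, p + h and p + 2h + 1 of Tower n.+1,
   where h is the height of Tower n. *)
Definition sub_index (n p o : nat) : nat :=
  (p + o * size (tower n) + (o == 2))%N.

Lemma nth_tower n p o : (p < size (tower n))%N -> (o < 3)%N ->
  (sub_index n p o < size (tower n.+1))%N /\
  (tower n.+1)`_(sub_index n p o) = (tower n)`_p + o%:R * width n.+1.
Proof.
move=> ph o3; rewrite size_towerS /sub_index.
split; first by case: o o3 => [|[|[|]]]//=; lia.
rewrite /= !nth_cat !size_map.
case: o o3 => [|[|[|]]]//= _.
- by rewrite mul0n !addn0 ph mul0r addr0.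
- rewrite mul1n addn0 ltnNge leq_addl/= addnK ph mul1r.
  by rewrite (nth_map 0).
- rewrite ifN; last by rewrite -leqNgt; lia.
  rewrite ifN; last by rewrite -leqNgt; lia.
  rewrite (_ : _ - _ - _ = p.+1)%N; last by lia.
  by rewrite /= (nth_map 0).
Qed.

Lemma nth_tower_spacer n :
  (tower n.+1)`_(2 * size (tower n))%N = (size (tower n))%:R * width n.
Proof.
rewrite /= !nth_cat !size_map ifN -?leqNgt; last by lia.
rewrite ifN -?leqNgt; last by lia.
by rewrite (_ : _ - _ - _ = 0)%N//; lia.
Qed.

Lemma sub_index_surj n k : (k < size (tower n.+1))%N ->
  k = (2 * size (tower n))%N \/
  exists p o, [/\ (p < size (tower n))%N, (o < 3)%N & k = sub_index n p o].
Proof.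
rewrite size_towerS /sub_index; set h := size _ => kh.
have [k1|k1] := ltnP k h; first by right; exists k, 0%N; split => //=; lia.
have [k2|k2] := ltnP k (2 * h).
  by right; exists (k - h)%N, 1%N; split => //=; lia.
have [->|k3] := eqVneq k (2 * h)%N; first by left.
by right; exists (k - 2 * h - 1)%N, 2%N; split => //=; lia.
Qed.

Lemma level_inj n i j x : (i < size (tower n))%N -> (j < size (tower n))%N ->
  level n (tower n)`_i x -> level n (tower n)`_j x -> i = j.
Proof.
elim: n i j x => [|n IH] i j x; first by rewrite /=; lia.
have w0 := width_gt0 n.+1; have wS := widthS n.
have sp p o : (p < size (tower n))%N -> (o < 3)%N ->
    level n.+1 ((tower n)`_p + o%:R * width n.+1) x ->
    level n (tower n)`_p x /\ x < (size (tower n))%:R * width n.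
  move=> ph o3; rewrite /level/= !in_itv/= => hx.
  have {}hx : (tower n)`_p <= x < (tower n)`_p + width n.
    by case: o o3 hx => [|[|[|]]]//= _; lra.
  split=> //.
  have /tower_cover : (\bigcup_(a in [set a : R | a \in tower n]) level n a) x.
    by exists (tower n)`_p; rewrite /= ?mem_nth// in_itv/=.
  by case/andP.
move=> /sub_index_surj[->|[p [ o [ph o3 ->]]]];
  move=> /sub_index_surj[->|[q [r [qh r3 ->]]]] //.
- rewrite nth_tower_spacer (nth_tower qh r3).2 => hx /(sp _ _ qh r3)[_ hx'].
  by exfalso; move: hx hx'; rewrite /level/= in_itv/=; lra.
- rewrite nth_tower_spacer (nth_tower ph o3).2 => /(sp _ _ ph o3)[_ hx] hx'.
  by exfalso; move: hx hx'; rewrite /level/= in_itv/=; lra.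
- rewrite (nth_tower ph o3).2 (nth_tower qh r3).2 => hx hx'.
  have pq := IH _ _ _ ph qh (sp _ _ ph o3 hx).1 (sp _ _ qh r3 hx').1.
  move: hx hx'; rewrite pq /level/= !in_itv/= => hx hx'; congr sub_index.
  by case: o r o3 r3 hx hx' => [|[|[|]]]//= [|[|[|]]]//= _ _ hx hx'; exfalso; lra.
Qed.

Lemma chacon_graph_lift n m x y :
  (exists i, [/\ (i.+1 < size (tower n))%N, level n (tower n)`_i x
                & y = x - (tower n)`_i + (tower n)`_i.+1]) ->
  exists i, [/\ (i.+1 < size (tower (m + n)))%N,
    level (m + n) (tower (m + n))`_i x
  & y = x - (tower (m + n))`_i + (tower (m + n))`_i.+1].
Proof.
move=> h; elim: m => [//|m]; rewrite addSn; move: (m + n)%N => {h}n.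
have wS := widthS n.
move=> [i [iS]]; rewrite {1}/level/= in_itv/= => xi ->.
have [ o o3 xo] : exists2 o, (o < 3)%N &
    (tower n)`_i + o%:R * width n.+1 <= x
      < (tower n)`_i + o%:R * width n.+1 + width n.+1.
  have [?|?] := ltP x ((tower n)`_i + width n.+1); first by exists 0%N => //; lra.
  have [?|?] := ltP x ((tower n)`_i + 2 * width n.+1).
    by exists 1%N => //; lra.
  by exists 2%N => //; lra.
have [s1 e1] := nth_tower (ltnW iS) o3; have [s2 e2] := nth_tower iS o3.
exists (sub_index n i o); rewrite /level e1 -[(sub_index n i o).+1]/(sub_index n i.+1 o).
by split => //; rewrite e2; ring.
Qed.

Lemma chacon_graph_inj x y x' y' : chacon_graph x y -> chacon_graph x' y' ->
  (x = x') <-> (y = y').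
Proof.
move=> [n G] [n' G'].
have [i [iS xi ->]] := chacon_graph_lift n' G.
have [j [jS xj ->]] := chacon_graph_lift n G'.
rewrite addnC in jS xj *; move: (n' + n)%N iS xi jS xj => {G G'} {}n iS xi jS xj.
have h k z : level n (tower n)`_k z ->
    level n (tower n)`_k.+1 (z - (tower n)`_k + (tower n)`_k.+1).
  by rewrite /level/= !in_itv/=; lra.
split=> e.
- by move: xj; rewrite -e => /(level_inj (ltnW iS) (ltnW jS) xi) ->.
- have := h _ _ xj; rewrite -e => /(level_inj iS jS (h _ _ xi)) [ij].
  by move: e; rewrite ij; lra.
Qed.

Lemma chaconE x y : chacon_graph x y -> chacon x = y.
Proof.
move=> G; rewrite /chacon; case: xgetP => [z _ Gz|/(_ y)//].
exact/(chacon_graph_inj Gz G).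
Qed.

Lemma chacon_invE x y : chacon_graph x y -> chacon_inv y = x.
Proof.
move=> G; rewrite /chacon_inv; case: xgetP => [z _ Gz|/(_ x)//].
exact/(chacon_graph_inj Gz G).
Qed.

Lemma measurable_chacon_space :
  measurable (chacon_space : set (measurableTypeR R)).
Proof. by rewrite chacon_spaceE; exact: measurable_itv. Qed.

(* The points outside of [chacon_space] form a null set. *)
Definition chacon_measure : set (measurableTypeR R) -> \bar R :=
  mrestr lebesgue_measure measurable_chacon_space.

HB.instance Definition _ := Measure.on chacon_measure.

Lemma chacon_measure_setT : chacon_measure [set: _] = 1%E.
Proof.
rewrite /chacon_measure /mrestr setTI chacon_spaceE.
by rewrite lebesgue_measure_itv/= lte_fin ltr01 oppr0 adde0.
Qed.

HB.instance Definition _ := @Measure_isProbability.Build _ _ R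
  chacon_measure chacon_measure_setT.

End chacon.

(* Main.v *)
Require Import Defs.
From mathcomp Require Import all_boot all_order all_algebra.
From mathcomp Require Import zify ring lra.
From mathcomp Require Import all_classical all_reals all_analysis.
From mathcomp Require Import measurable_realfun.

(** Fix a level A of Tower m that has a level below it, A-, and one above it,
    A+, and let w be its measure.  For every integer k <> 0,

      mu (A cap T^-k A) <= 9 (mu (A cap T^-k A-) + mu (A cap T^-k A+)),

    which is [overlap_neighbours].  If T^(k_j) converged weakly to
    alpha Theta + (1 - alpha) Id, the left-hand side would tend to
    alpha w^2 + (1 - alpha) w and the right-hand side to 18 alpha w^2.  As w
    can be taken arbitrarily small, this forces k_j = 0 for all large j; but
    then the left-hand side equals w, whereas its limit is less than w because
    alpha > 0 and w < 1.

    The inequality says that returns to A at time k are dominated by near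
    misses, and it comes from the irregular placement of the spacers.  It
    suffices to treat k > 0: negative k amount to exchanging the two sets.  If
    k < h_m, no point of A returns at time k.  Otherwise choose n >= m with
    h_n <= k < h_(n+1).  Going up a very high tower, one reads copies of Tower n
    separated by at most one spacer.  A point x of A in the j-th copy that
    returns to A at time k is carried by T^k into the (j+a)-th copy, with
    1 <= a <= 4, and its new position there depends on the number sigma(j) of spacers met between copies j and j+a.
    From j to j+1, sigma changes by at most 1, and it takes two different values
    among any ten consecutive j; so some j' = j+u with 1 <= u <= 9 has
    sigma(j') = sigma(j) +- 1 ([window_step]).  Moving x to the same position in
    the j'-th copy leaves it in A, but shifts its image by one level, from A to
    A- or A+ ([block_neighbour]).  This correspondence is at most 9 to 1, which
    gives the inequality between numbers of levels of Tower m + d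
    ([leq_card_matches]), up to an error that does not depend on d.  The error
    is multiplied by the width of these levels, and disappears as d tends to
    infinity ([overlap_iter], [overlap_iter_inv], [le_add_width]). *)

Set Implicit Arguments.
Unset Strict Implicit.
Unset Printing Implicit Defensive.

Import Order.TTheory GRing.Theory Num.Theory.
Import numFieldNormedType.Exports.

(** * Positions of the copies of a tower inside the higher towers *)

Section combinatorics.
Local Open Scope nat_scope.

Fixpoint height (n : nat) : nat := if n is m.+1 then 3 * height m + 1 else 1.

(** The number of spacers between copies j and j+1 of any tower.  It is 1 exactly
    when the first ternary digit of j that is not 2 equals 1; after adding 1,
    that digit becomes the last nonzero digit of j+1. *)
Definition spacer (j : nat) : nat := (j.+1)`_3^' %% 3 == 2.

Definition spacers (j : nat) : nat := \sum_(i < j) spacer i.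

(** The index of the bottom level of copy j of Tower n, in every tower that is
    high enough to contain that copy. *)
Definition start (n j : nat) : nat := j * height n + spacers j.

Lemma height_gt0 n : 0 < height n.
Proof. by case: n => //= n; lia. Qed.

Lemma spacer_le1 j : spacer j <= 1.
Proof. exact: leq_b1. Qed.

Lemma spacer_mul3 j : spacer (3 * j) = 0.
Proof.
by rewrite /spacer part_pnat_id ?p'natE//; lia.
Qed.

Lemma spacer_mul3D1 j : spacer (3 * j).+1 = 1.
Proof.
by rewrite /spacer part_pnat_id ?p'natE//; lia.
Qed.

Lemma spacer_mul3D2 j : spacer (3 * j).+2 = spacer j.
Proof.
rewrite /spacer (_ : (3 * j).+3 = 3 * j.+1); last by lia.
by rewrite partnM// part_p'nat ?mul1n// /pnat.
Qed.

Lemma spacersS j : spacers j.+1 = spacers j + spacer j.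
Proof. by rewrite /spacers big_ord_recr. Qed.

Lemma spacers0 : spacers 0 = 0.
Proof. by rewrite /spacers big_ord0. Qed.

(** Three consecutive copies of Tower n, starting at a multiple of 3, make up a
    copy of Tower n+1: inside it there is one spacer, and between such triples
    the spacers are those of Tower n+1. *)
Lemma spacers_mul3 j : spacers (3 * j) = j + spacers j.
Proof.
elim: j => [|j IH]; first by rewrite !spacers0.
rewrite (_ : 3 * j.+1 = (3 * j).+3); last by lia.
by rewrite !spacersS IH spacer_mul3 spacer_mul3D1 spacer_mul3D2; lia.
Qed.

Lemma spacers_mul3D j o : o < 3 -> spacers (3 * j + o) = j + spacers j + (o == 2).
Proof.
case: o => [|[|[|]]]//= _.
- by rewrite !addn0 spacers_mul3.
- by rewrite addn1 addn0 spacersS spacer_mul3 spacers_mul3 addn0.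
- by rewrite addn2 !spacersS spacer_mul3D1 spacer_mul3 spacers_mul3 addn0.
Qed.

Lemma startS n j : start n j.+1 = start n j + height n + spacer j.
Proof. by rewrite /start spacersS mulSn; nia. Qed.

Lemma start0 n : start n 0 = 0.
Proof. by rewrite /start spacers0. Qed.

Lemma start_mono n i j : i <= j -> start n i + (j - i) * height n <= start n j.
Proof.
elim: j => [|j IH]; first by rewrite leqn0 => /eqP->; rewrite sub0n mul0n addn0.
rewrite leq_eqVlt => /orP[/eqP->|]; first by rewrite subnn mul0n addn0.
by move=> ij; have := IH ij; rewrite startS subSn// mulSn; lia.
Qed.

Lemma start_le n i j : i <= j ->
  start n j <= start n i + (j - i) * (height n).+1.
Proof.
elim: j => [|j IH]; first by rewrite leqn0 => /eqP->; rewrite sub0n mul0n addn0.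
rewrite leq_eqVlt => /orP[/eqP->|]; first by rewrite subnn mul0n addn0.
by move=> ij; have := IH ij; rewrite startS subSn// mulSn; have := spacer_le1 j; lia.
Qed.

Lemma start_homo n i j : i <= j -> start n i <= start n j.
Proof. by move=> /(start_mono n); apply/leq_trans/leq_addr. Qed.

Lemma start_ltE n i j : (start n i < start n j) = (i < j).
Proof.
apply/idP/idP => [|ij].
  by apply: contraTT; rewrite -!leqNgt; exact: start_homo.
by have := start_homo n ij; rewrite startS; have := height_gt0 n; lia.
Qed.

Lemma start_inj n : injective (start n).
Proof.
by move=> i j e; case: (ltngtP i j) => //; rewrite -(start_ltE n) e ltnn.
Qed.

Lemma start_mul3D n j o : o < 3 ->
  start n (3 * j + o) = start n.+1 j + start n o.
Proof.
move=> o3; rewrite /start spacers_mul3D//.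
have := spacers_mul3D 0 o3; rewrite muln0 add0n => ->.
by rewrite spacers0 /=; nia.
Qed.

(** Tower m+d contains 3^d copies of Tower m, arranged in the same way in each of
    its own copies. *)
Lemma start_expD m d j J : J < 3 ^ d ->
  start m (3 ^ d * j + J) = start (m + d) j + start m J.
Proof.
elim: d m j J => [|d IH] m j J.
  rewrite expn0 ltnS leqn0 => /eqP->.
  by rewrite mul1n !addn0 start0 addn0.
rewrite expnS => Jd; rewrite (divn_eq J 3).
set q := J %/ 3; set o := J %% 3.
have o3 : o < 3 by rewrite ltn_mod.
have qd : q < 3 ^ d by rewrite ltn_divLR// mulnC.
rewrite (_ : 3 * 3 ^ d * j + _ = 3 * (3 ^ d * j + q) + o); last by nia.
by rewrite (mulnC q) !start_mul3D// IH// addSnnS; lia.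
Qed.

Lemma start_exp m d : start m (3 ^ d) = height (m + d).
Proof.
have := @start_expD m d 1 0; rewrite muln1 addn0 => -> //.
  by rewrite start0 addn0 startS start0 (spacer_mul3 0) addn0.
by rewrite expn_gt0.
Qed.

(** Where the two values differ is dictated by the residue of a modulo 3: spacers
    at positions 0 and 1 modulo 3 are known to be 0 and 1, and for a = 3 the
    positions 2 and 5 modulo 9 reproduce the positions 0 and 1. *)
Lemma spacer_shift_neq a j : 0 < a <= 4 ->
  exists2 t, t < 9 & spacer (j + t + a) != spacer (j + t).
Proof.
have w x : j <= x < j + 9 -> spacer (x + a) != spacer x ->
    exists2 t, t < 9 & spacer (j + t + a) != spacer (j + t).
  by move=> jx h; exists (x - j); rewrite ?subnKC//; lia.
case: a w => [|[|[|[|[|]]]]]// w _.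
- apply: (w (3 * ((j + 2) %/ 3))); first by lia.
  by rewrite addn1 spacer_mul3D1 spacer_mul3.
- apply: (w (3 * ((j + 1) %/ 3)).+1); first by lia.
  rewrite (_ : _ + 2 = 3 * ((j + 1) %/ 3).+1); last by lia.
  by rewrite spacer_mul3D1 spacer_mul3.
- apply: (w (3 * (3 * ((j + 6) %/ 9))).+2); first by lia.
  rewrite (_ : _ + 3 = (3 * (3 * ((j + 6) %/ 9)).+1).+2); last by lia.
  by rewrite !spacer_mul3D2 spacer_mul3D1 spacer_mul3.
- apply: (w (3 * ((j + 2) %/ 3))); first by lia.
  rewrite (_ : _ + 4 = (3 * ((j + 2) %/ 3).+1).+1); last by lia.
  by rewrite spacer_mul3D1 spacer_mul3.
Qed.

(** The number of spacers in the window [j, j+a[ changes by at most 1 when the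
    window slides by one step, and it is not constant on ten consecutive
    windows; the first change is by exactly 1. *)
Lemma window_step a j : 0 < a <= 4 -> exists2 u, 0 < u <= 9 &
     spacers (j + u + a) + spacers j = (spacers (j + a) + spacers (j + u)).+1
  \/ (spacers (j + u + a) + spacers j).+1 = spacers (j + a) + spacers (j + u).
Proof.
move=> a4; have [t0 t09 ne0] := spacer_shift_neq j a4.
have [t ne tmin] :=
  ex_minnP (ex_intro (fun t => spacer (j + t + a) != spacer (j + t)) _ ne0).
have t9 : t < 9 by apply: leq_ltn_trans t09; exact: tmin.
have same i : i <= t ->
    spacers (j + i + a) + spacers j = spacers (j + a) + spacers (j + i).
  elim: i => [|i IH] it; first by rewrite addn0.
  have /eqP e : spacer (j + i + a) == spacer (j + i).
    by apply/negPn/negP => /tmin; lia.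
  by rewrite addnS addSn !spacersS e; have := IH (ltnW it); lia.
exists t.+1; first by [].
have := same t (leqnn t); move: ne (spacer_le1 (j + t)) (spacer_le1 (j + t + a)).
by rewrite addnS addSn !spacersS; lia.
Qed.

(** J and J2 are copies of Tower m inside copies j and j2 of Tower n.  Both are
    moved by u copies of Tower n, where u comes from [window_step] applied to
    j2 - j; this changes the distance between them by exactly 1. *)
Lemma block_neighbour m n k J J2 : m <= n -> height n <= k < height n.+1 ->
  start m J2 = start m J + k -> exists2 u, 0 < u <= 9 &
  start m (J + 3 ^ (n - m) * u) <= start m J + 9 * k.+1 /\
  exists J', start m J' = start m (J + 3 ^ (n - m) * u) + k.+1
    \/ (start m J').+1 = start m (J + 3 ^ (n - m) * u) + k.
Proof.
move=> mn kn; set d := n - m; set q := 3 ^ d.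
have q0 : 0 < q by rewrite expn_gt0.
(* Copy I of Tower m is copy r inside copy j of Tower n, and moving by v copies
   of Tower n keeps r. *)
have dec I : exists j r, [/\ I = q * j + r,
    forall v, start m (q * (j + v) + r) = start n (j + v) + start m r
    & start m r < height n].
  exists (I %/ q), (I %% q); have rq : I %% q < q by rewrite ltn_mod.
  split; first by rewrite mulnC -divn_eq.
    by move=> v; rewrite start_expD// subnKC.
  by rewrite -(subnKC mn) -start_exp start_ltE.
have [j [r [-> eJ r_lt]]] := dec J; have [j2 [r2 [-> eJ2 r2_lt]]] := dec J2.
have := eJ 0; have := eJ2 0; rewrite !addn0 => -> -> e.
(* k is at least the height of Tower n, hence reaches another copy of it. *)
have jj2 : j < j2.
  rewrite ltnNge; apply/negP => jj.
  by have := start_homo n jj; lia.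
(* Five copies of Tower n are too many: 5 h > h + k, since k <= 3 h. *)
have j24 : j2 <= j + 4.
  rewrite leqNgt; apply/negP => jj.
  have := start_mono n (ltnW (leq_ltn_trans (leq_addr 4 j) jj)).
  have : 5 * height n <= (j2 - j) * height n by rewrite leq_mul2r; lia.
  by have := height_gt0 n; move: kn => /=; lia.
have [|u u9 h] := @window_step (j2 - j) j; first by lia.
have le_u := start_le n (leq_addr u j).
rewrite addKn in le_u.
exists u => //; rewrite (_ : q * j + r + q * u = q * (j + u) + r); last by nia.
rewrite eJ; split.
  have : u * (height n).+1 <= 9 * k.+1 by apply: leq_mul; lia.
  lia.
exists (q * (j2 + u) + r2); rewrite eJ2.
by move: h e; rewrite addnAC subnKC 1?ltnW// /start !mulnDl; lia.
Qed.

Lemma height_scale m k : height m <= k ->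
  exists2 n, m <= n & height n <= k < height n.+1.
Proof.
have gtn i : i < height i by elim: i => //= i IH; lia.
move=> mk; pose P n := (m <= n) && (height n <= k).
have exP : exists n, P n by exists m; rewrite /P leqnn.
have ubP n : P n -> n <= k by move=> /andP[_]; have := gtn n; lia.
have [n /andP[mn nk] nmax] := ex_maxnP exP ubP.
exists n => //; rewrite nk ltnNge; apply/negP => nk'.
by have := nmax n.+1; rewrite /P nk' leqW// ltnn => /(_ isT).
Qed.

Lemma leq_card_rel (T U : finType) (A : {set T}) (B : {set U})
    (r : T -> U -> bool) :
  {in A, forall x, exists2 y, y \in B & r x y} ->
  {in A &, forall x x' y, r x y -> r x' y -> x = x'} -> #|A| <= #|B|.
Proof.
move=> ex uniq; pose f x := [pick y in B | r x y].
have fP x : x \in A -> exists y, [/\ f x = Some y, y \in B & r x y].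
  move=> xA; have [y yB rxy] := ex x xA; rewrite /f.
  case: pickP => [z /andP[zB rxz]|/(_ y)]; first by exists z.
  by rewrite yB rxy.
have Some_inj : injective (@Some U) by move=> y y' [].
rewrite -(card_imset B Some_inj) -(@card_in_imset _ _ f A); last first.
  move=> x x' xA x'A; have [y [-> _ xy]] := fP x xA.
  have [y' [-> _ x'y]] := fP x' x'A => -[e].
  by apply: (uniq _ _ xA x'A y); rewrite // e.
apply/subset_leq_card/fintype.subsetP => _ /imsetP[x /fP[y [-> yB _]] ->].
exact: imset_f.
Qed.

Lemma leq_card_nat (T : finType) (A : {set T}) (f : T -> nat) c :
  {in A &, injective f} -> {in A, forall x, f x < c} -> #|A| <= c.
Proof.
move=> inj lt; rewrite -[leqRHS]card_ord -(cardsT 'I_c).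
apply: (@leq_card_rel _ _ _ _ (fun x (i : 'I_c) => f x == i))
  => [x xA|x x' xA x'A i].
  by exists (Ordinal (lt x xA)); rewrite ?inE.
by move=> /eqP e /eqP e'; apply: inj; rewrite // e.
Qed.

(** The levels of Tower m+d inside level p of Tower m are indexed by the copies
    J < 3^d of Tower m.  Passing from level p in copy J to level q in copy J2 by
    k steps up means [start m J2 + q = start m J + p + k]; only p + k - q
    matters, and it is represented by t - s. *)
Definition matches m d s t :=
  [set P : 'I_(3 ^ d) * 'I_(3 ^ d) | start m P.2 + s == start m P.1 + t].

Lemma matches_fst_inj m d s t : {in matches m d s t &, injective fst}.
Proof.
move=> [J J2] [I I2]; rewrite !inE /= => /eqP eJ /eqP eI e.
rewrite e -eI in eJ; congr pair => //; apply/val_inj/(@start_inj m).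
exact: addIn eJ.
Qed.

Lemma matches_snd_inj m d s t : {in matches m d s t &, injective snd}.
Proof.
move=> [J J2] [I I2]; rewrite !inE /= => /eqP eJ /eqP eI e.
rewrite e eI in eJ; congr pair => //; apply/val_inj/(@start_inj m)/esym.
exact: addIn eJ.
Qed.

(** Each pair at distance k, except for those near the top of the tower, is sent
    by [block_neighbour] to one of the nine values of u and a pair at distance
    k + 1 or k - 1, from which it can be recovered. *)
Lemma leq_card_matches m d k : 0 < k ->
  #|matches m d 0 k| <=
    9 * (#|matches m d 0 k.+1| + #|matches m d 1 k|) + 10 * k.+1.
Proof.
move=> k0; have [km|km] := ltnP k (height m).
  rewrite (_ : matches m d 0 k = finset.set0) ?cards0//.
  apply/finset.setP => -[J J2].
  rewrite !inE /= addn0; apply/negbTE/eqP => e.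
  have JJ : J < J2 by rewrite -(start_ltE m) e; lia.
  by have := start_homo m JJ; rewrite startS; lia.
have [n mn kn] := height_scale km.
set G := matches m d 0 k; set c := 10 * k.+1.
(* For these pairs the correspondence stays inside Tower m+d; the other pairs
   have their first component among the last c copies. *)
pose far :=
  [set P : 'I_(3 ^ d) * 'I_(3 ^ d) | start m P.1 + c < start m (3 ^ d)].
rewrite -(cardsID far G) leq_add//; last first.
  apply: (@leq_card_nat _ _
    (fun P : 'I_(3 ^ d) * 'I_(3 ^ d) => 3 ^ d - P.1.+1)) => [P P'|P].
    rewrite !inE => /andP[_ PG] /andP[_ PG'] e.
    apply: (@matches_fst_inj m d 0 k); rewrite ?inE//; apply/val_inj => /=.
    by have := congr1 (subn (3 ^ d)) e; rewrite !subKn ?ltn_ord// => -[].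
  rewrite !inE => /andP[h _]; rewrite -leqNgt in h.
  have := leq_trans (start_mono m (ltnW (ltn_ord P.1))) h.
  rewrite leq_add2l; rewrite subnSK ?ltn_ord//; apply: leq_trans.
  exact: leq_pmulr (height_gt0 m).
apply: (@leq_trans (9 * #|matches m d 0 k.+1 :|: matches m d 1 k|)); last first.
  by rewrite leq_mul2l/= cardsU leq_subr.
rewrite -[X in X * _](card_ord 9) -cardsT -cardsX.
apply: (@leq_card_rel _ _ _ _ (fun (P : 'I_(3 ^ d) * 'I_(3 ^ d))
    (uQ : 'I_9 * ('I_(3 ^ d) * 'I_(3 ^ d))) =>
    uQ.2.1 == P.1 + 3 ^ (n - m) * uQ.1.+1 :> nat)) => [[J J2]|P P' PG PG' uQ].
  rewrite !inE /= addn0 => /andP[/eqP e h].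
  have [u u9 [le_c [J' hJ']]] := block_neighbour mn kn e.
  set I := J + _ in le_c hJ'.
  have Id : I < 3 ^ d by rewrite -(start_ltE m); lia.
  have J'd : J' < 3 ^ d by rewrite -(start_ltE m); lia.
  have u9' : u.-1 < 9 by lia.
  exists (Ordinal u9', (Ordinal Id, Ordinal J'd)); last first.
    by rewrite /= /I; case: u u9 {le_c hJ' I Id u9'} => // u; rewrite eqxx.
  by rewrite !inE /= addn0 addn1; case: hJ' => ->; rewrite eqxx ?orbT.
move=> /eqP e /eqP; rewrite e => /addIn /val_inj.
by apply: (@matches_fst_inj m d 0 k); [move: PG|move: PG']; rewrite inE => /andP[].
Qed.

End combinatorics.

(** * Levels of the towers as subsets of the space *)

Local Open Scope classical_set_scope.
Local Open Scope ring_scope.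

Section cells.
Variable R : realType.
Implicit Types (x : R) (n m p i k : nat).

Lemma size_tower n : size (tower R n) = height n.
Proof. by elim: n => // n IH; rewrite size_towerS IH. Qed.

Definition cell n i : set R := level n (tower R n)`_i.

Lemma cellE n i x :
  cell n i x = ((tower R n)`_i <= x < (tower R n)`_i + width R n) :> Prop.
Proof. by rewrite /cell /level /= in_itv. Qed.

Lemma cell_inj n i j x : (i < height n)%N -> (j < height n)%N ->
  cell n i x -> cell n j x -> i = j.
Proof. by rewrite -!size_tower; exact: level_inj. Qed.

Lemma cell_split m p x : (p < height m)%N ->
  cell m p x <-> exists2 o, (o < 3)%N & cell m.+1 (start m o + p) x.
Proof.
move=> pm; have wS := widthS R m; have w0 := width_gt0 R m.+1.
have E o : (o < 3)%N -> cell m.+1 (start m o + p) x =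
    ((tower R m)`_p + o%:R * width R m.+1 <= x
      < (tower R m)`_p + o%:R * width R m.+1 + width R m.+1) :> Prop.
  move=> o3; have ps : (p < size (tower R m))%N by rewrite size_tower.
  rewrite cellE -(nth_tower ps o3).2 (_ : (_ + p)%N = sub_index R m p o)//.
  rewrite /sub_index size_tower /start.
  by have := spacers_mul3D 0 o3; rewrite muln0 spacers0 add0n => ->; lia.
rewrite cellE; split=> [h|[ o o3]]; last first.
  by rewrite E//; case: o o3 => [|[|[|]]]//= _; lra.
have [?|?] := ltP x ((tower R m)`_p + width R m.+1).
  by exists 0%N => //; rewrite E//; lra.
have [?|?] := ltP x ((tower R m)`_p + 2 * width R m.+1).
  by exists 1%N => //; rewrite E//; lra.
by exists 2%N => //; rewrite E//; lra.
Qed.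

Lemma start_lt_height m d J p : (J < 3 ^ d)%N -> (p < height m)%N ->
  (start m J + p < height (m + d))%N.
Proof.
by move=> Jd pm; have := start_homo m Jd; rewrite start_exp startS; lia.
Qed.

(** By induction on d, cutting the levels of Tower m first: level p of Tower m
    consists of level p of its copies o = 0, 1, 2 in Tower m+1. *)
Lemma cell_refine m d p x : (p < height m)%N ->
  cell m p x <-> exists2 J, (J < 3 ^ d)%N & cell (m + d) (start m J + p) x.
Proof.
elim: d m p => [|d IH] m p pm.
  rewrite addn0 expn0; split=> [h|[J]]; first by exists 0%N; rewrite // start0.
  by rewrite ltnS leqn0 => /eqP ->; rewrite start0.
rewrite cell_split// -addSnnS; split=> [[ o o3]|[J Jd]].
  move=> /IH[|J Jd h].
    by have := @start_lt_height m 1 o p o3 pm; rewrite addn1.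
  exists (3 * J + o)%N; first by rewrite expnS; lia.
  by rewrite start_mul3D// -addnA.
have o3 : (J %% 3 < 3)%N by rewrite ltn_mod.
rewrite {1}(divn_eq J 3) mulnC start_mul3D// -addnA => h.
exists (J %% 3)%N => //; apply/IH.
  by have := @start_lt_height m 1 _ p o3 pm; rewrite addn1.
by exists (J %/ 3)%N => //; rewrite ltn_divLR// mulnC -expnS.
Qed.

Lemma cell_step n i x : (i.+1 < height n)%N -> cell n i x ->
  cell n i.+1 (chacon x).
Proof.
move=> iS xi; have G : chacon_graph x (x - (tower R n)`_i + (tower R n)`_i.+1).
  by exists n, i; rewrite size_tower.
by rewrite (chaconE G); move: xi; rewrite !cellE; lra.
Qed.

Lemma cell_step_inv n i x : (i.+1 < height n)%N -> cell n i.+1 x ->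
  cell n i (chacon_inv x).
Proof.
move=> iS xi; pose y := x - (tower R n)`_i.+1 + (tower R n)`_i.
have yi : cell n i y by move: xi; rewrite !cellE /y; lra.
have G : chacon_graph y x.
  by exists n, i; rewrite size_tower; split => //; rewrite /y; ring.
by rewrite (chacon_invE G).
Qed.

Lemma cell_iter n i k x : (i + k < height n)%N ->
  cell n i x -> cell n (i + k) (iter k (@chacon R) x).
Proof.
elim: k => [|k IH] ik xi; first by rewrite addn0.
by rewrite addnS iterS; apply: cell_step; [lia|apply: IH => //; lia].
Qed.

Lemma cell_iter_inv n i k x : (i + k < height n)%N ->
  cell n (i + k) x -> cell n i (iter k (@chacon_inv R) x).
Proof.
elim: k i => [|k IH] i ik xi; first by rewrite addn0 in xi.
rewrite iterS; apply: cell_step_inv; first by lia.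
by apply: IH; rewrite addSnnS.
Qed.

Lemma cell_sub_space n i : (i < height n)%N -> cell n i `<=` @chacon_space R.
Proof.
move=> ih x xi; exists n => //; exists (tower R n)`_i => //=.
by rewrite mem_nth ?size_tower.
Qed.

Lemma measurable_cell n i : measurable (cell n i : set (measurableTypeR R)).
Proof. exact: measurable_itv. Qed.

Lemma measure_cell n i : (i < height n)%N ->
  @chacon_measure R (cell n i) = (width R n)%:E.
Proof.
move=> ih; rewrite /chacon_measure /mrestr setIidl; last exact: cell_sub_space.
rewrite /cell /level lebesgue_measure_itv/= lte_fin ltrDl width_gt0.
by rewrite -EFinB; congr EFin; ring.
Qed.

Definition cells n (s : seq nat) : set R :=
  [set x | exists2 i, i \in s & cell n i x].

Lemma cells_cons n i s : cells n (i :: s) = cell n i `|` cells n s.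
Proof.
apply/seteqP; split=> x /=.
  by move=> [j]; rewrite inE => /orP[/eqP->|js] h; [left|right; exists j].
by move=> [h|[j js h]]; [exists i|exists j]; rewrite // inE ?eqxx// js orbT.
Qed.

Lemma measurable_cells n s : measurable (cells n s : set (measurableTypeR R)).
Proof.
elim: s => [|i s IH]; last first.
  by rewrite cells_cons; apply: measurableU => //; exact: measurable_cell.
rewrite (_ : cells _ _ = set0)//; apply/seteqP; split=> // x [].
by [].
Qed.

Lemma measure_cells n s : uniq s -> {in s, forall i, (i < height n)%N} ->
  @chacon_measure R (cells n s) = ((size s)%:R * width R n)%:E.
Proof.
elim: s => [_ _|i s IH /= /andP[si us] sh].
  rewrite mul0r (_ : cells _ _ = set0) ?measure0//.
  by apply/seteqP; split=> // x [].
have ih : (i < height n)%N by apply: sh; rewrite inE eqxx.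
have {}sh : {in s, forall j, (j < height n)%N}.
  by move=> j js; apply: sh; rewrite inE js orbT.
rewrite cells_cons measureU.
- rewrite [X in (X + _)%E](measure_cell ih) [X in (_ + X)%E]IH//.
  by rewrite -EFinD; congr EFin; rewrite -[(size s).+1]addn1 natrD; ring.
- exact: measurable_cell.
- exact: measurable_cells.
apply/seteqP; split=> // x [xi [j js xj]].
by move: si; rewrite (cell_inj ih (sh j js) xi xj) js.
Qed.

End cells.

(** * Integrals of indicators *)

Section integral.
Context d (T : measurableType d) (R : realType).

(** Immediate from the definition of the integral as a supremum over simple
    functions.  It is applied to indicators of sets involving powers of T, whose
    measurability is left open. *)
Lemma ge0_le_integralT (mu : {measure set T -> \bar R}) (f g : T -> \bar R) :
  (forall x, (0 <= f x)%E) -> (forall x, (f x <= g x)%E) ->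
  (\int[mu]_x f x <= \int[mu]_x g x)%E.
Proof.
move=> f0 fg; have g0 x : (0 <= g x)%E by exact: le_trans (fg x).
rewrite !ge0_integralTE//; apply: le_ereal_sup => _ [h hf <-].
by exists h => // x; exact: le_trans (fg x).
Qed.

Variable P : probability T R.

Let integral_indicT (A : set T) : measurable A ->
  (\int[P]_x (\1_A x)%:E = P A)%E.
Proof. by move=> mA; rewrite integral_indic// setIT. Qed.

Lemma Rintegral_indic (A : set T) : measurable A ->
  \int[P]_x \1_A x = fine (P A).
Proof. by move=> mA; rewrite /Rintegral integral_indicT. Qed.

Let le_indic (A B : set T) : A `<=` B ->
  (\int[P]_x (\1_A x)%:E <= \int[P]_x (\1_B x)%:E)%E.
Proof.
move=> AB; apply: ge0_le_integralT => x; rewrite lee_fin//.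
by rewrite !indicE; case: (boolP (x \in A)) => [/set_mem/AB/mem_set ->|].
Qed.

Let fin_num_indic (A : set T) : (\int[P]_x (\1_A x)%:E)%E \is a fin_num.
Proof.
apply/fin_numPlt; apply/andP; split.
  by rewrite (lt_le_trans (ltNyr 0))// integral_ge0// => x _; rewrite lee_fin.
rewrite (le_lt_trans (le_indic (@subsetT _ A)))// integral_indicT//.
by rewrite probability_setT ltry.
Qed.

Lemma le_Rintegral_indic (A B : set T) : A `<=` B ->
  \int[P]_x \1_A x <= \int[P]_x \1_B x.
Proof. by move=> AB; apply: fine_le; [| |exact: le_indic]. Qed.

Lemma Lfun_indic (A : set T) : measurable A -> \1_A \in Lfun P 2%:E.
Proof.
move=> mA; rewrite inE/=; apply/andP; split; rewrite inE/=.
  exact: measurable_indic.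
rewrite /finite_norm unlock poweR_lty//.
have indic2 x : `|\1_A x : R| `^ 2 = \1_A x.
  by rewrite indicE; case: (_ \in _); rewrite ?normr1 ?powR1// normr0 powR0.
under eq_integral do rewrite /= indic2.
rewrite integral_indicT// (le_lt_trans (probability_le1 _ mA))//.
exact: ltry.
Qed.

End integral.

(** * From measures of overlaps to numbers of levels *)

Section overlap.
Variable R : realType.
Implicit Types (tau : R -> R).
Local Notation P := (@chacon_measure R).

(** The matrix coefficient of the Koopman operator of tau between levels q and p
    of Tower m. *)
Definition overlap tau m p q : R :=
  \int[P]_x (\1_(@cell R m q) (tau x) * \1_(@cell R m p) x).

Lemma overlapE tau m p q :
  overlap tau m p q = \int[P]_x \1_(@cell R m p `&` tau @^-1` @cell R m q) x.
Proof.
rewrite /overlap; congr Rintegral; apply/funext => x.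
rewrite indicI mulrC; congr (_ * _).
Qed.

Definition copies m d p (B : {set 'I_(3 ^ d)}) : set R :=
  cells (m + d) [seq (start m J + p)%N | J : 'I_(3 ^ d) <- enum B].

Lemma copiesP m d p (B : {set 'I_(3 ^ d)}) x :
  copies m p B x <->
  exists2 J : 'I_(3 ^ d), J \in B & cell (m + d) (start m J + p) x.
Proof.
split=> [[_ /mapP[J JB ->] h]|[J JB h]].
  by exists J => //; rewrite -mem_enum.
by exists (start m J + p)%N => //; apply: map_f; rewrite mem_enum.
Qed.

Lemma Rintegral_copies m d p (B : {set 'I_(3 ^ d)}) : (p < height m)%N ->
  \int[P]_x \1_(copies m p B) x = #|B|%:R * width R (m + d).
Proof.
move=> pm; rewrite Rintegral_indic; last exact: measurable_cells.
rewrite [X in fine X]measure_cells ?size_map -?cardE//.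
  rewrite map_inj_uniq ?enum_uniq// => J J' /addIn/start_inj.
  exact: val_inj.
by move=> _ /mapP[J _ ->]; exact: start_lt_height.
Qed.

Lemma overlap_le tau m d p q (B : {set 'I_(3 ^ d)}) : (p < height m)%N ->
  (forall (J : 'I_(3 ^ d)) x, cell (m + d) (start m J + p) x ->
    cell m q (tau x) -> J \in B) ->
  overlap tau m p q <= #|B|%:R * width R (m + d).
Proof.
move=> pm h; rewrite overlapE -(Rintegral_copies B pm).
apply: le_Rintegral_indic => x [/(cell_refine d x pm)[J Jd xJ] xq].
by apply/copiesP; exists (Ordinal Jd) => //; exact: (h (Ordinal Jd) x).
Qed.

Lemma overlap_ge tau m d p q (B : {set 'I_(3 ^ d)}) : (p < height m)%N ->
  (forall (J : 'I_(3 ^ d)) x, J \in B ->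
    cell (m + d) (start m J + p) x -> cell m q (tau x)) ->
  #|B|%:R * width R (m + d) <= overlap tau m p q.
Proof.
move=> pm h; rewrite overlapE -(Rintegral_copies B pm).
apply: le_Rintegral_indic => x /copiesP[J JB xJ]; split.
  by apply/(cell_refine d x pm); exists J.
exact: h xJ.
Qed.

(** The common part of the estimates for T^k and T^-k: f selects the copy of
    Tower m from which a pair of copies departs, and E contains the copies that
    leave Tower m+d within k steps. *)
Lemma overlap_matches tau m d p q1 q2 k e
    (f : 'I_(3 ^ d) * 'I_(3 ^ d) -> 'I_(3 ^ d)) (A A1 A2 : {set _})
    (E : {set 'I_(3 ^ d)}) : (p < height m)%N ->
  (#|A| <= 9 * (#|A1| + #|A2|) + 10 * k.+1)%N -> (#|E| <= e)%N ->
  (forall (J : 'I_(3 ^ d)) x, cell (m + d) (start m J + p) x ->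
    cell m p (tau x) -> J \in f @: A :|: E) ->
  {in A1 &, injective f} ->
  (forall Q x, Q \in A1 -> cell (m + d) (start m (f Q) + p) x ->
    cell m q1 (tau x)) ->
  {in A2 &, injective f} ->
  (forall Q x, Q \in A2 -> cell (m + d) (start m (f Q) + p) x ->
    cell m q2 (tau x)) ->
  overlap tau m p p <= 9 * (overlap tau m p q1 + overlap tau m p q2)
    + (10 * k.+1 + e)%:R * width R (m + d).
Proof.
move=> pm leA leE up f1 lo1 f2 lo2.
have ge1 : #|A1|%:R * width R (m + d) <= overlap tau m p q1.
  rewrite -(card_in_imset f1); apply: overlap_ge => // J x /imsetP[Q QA ->].
  exact: lo1.
have ge2 : #|A2|%:R * width R (m + d) <= overlap tau m p q2.
  rewrite -(card_in_imset f2); apply: overlap_ge => // J x /imsetP[Q QA ->].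
  exact: lo2.
apply: (le_trans (overlap_le pm up)).
have le0 : (#|f @: A :|: E| <=
    9 * (#|A1| + #|A2|) + (10 * k.+1 + e))%N.
  rewrite cardsU (leq_trans (leq_subr _ _))// addnA leq_add//.
  exact: leq_trans (leq_imset_card _ _) leA.
have w0 := width_gt0 R (m + d).
apply: (@le_trans _ _
    ((9 * (#|A1| + #|A2|) + (10 * k.+1 + e))%:R * width R (m + d))).
  by rewrite ler_pM2r// ler_nat.
by rewrite natrD natrM natrD; lra.
Qed.

(** A pair of copies at distance k, k + 1 or k - 1 describes the passage from
    level p+1 of the lower copy to level p+1, p or p+2 of the upper one. *)
Lemma overlap_iter m d p k : (p.+2 < height m)%N -> (0 < k)%N ->
  overlap (iter k (@chacon R)) m p.+1 p.+1 <=
    9 * (overlap (iter k (@chacon R)) m p.+1 p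
         + overlap (iter k (@chacon R)) m p.+1 p.+2)
    + (10 * k.+1 + (p.+1 + k))%:R * width R (m + d).
Proof.
move=> pm k0; set tau := iter k _; have pm1 := ltnW pm; have pm0 := ltnW pm1.
have down (J J2 : 'I_(3 ^ d)) q x : (q < height m)%N ->
    (start m J2 + q = start m J + p.+1 + k)%N ->
    cell (m + d) (start m J + p.+1) x -> cell m q (tau x).
  move=> qm e xJ; apply/(cell_refine d _ qm); exists J2 => //.
  by rewrite e; apply: cell_iter => //; rewrite -e start_lt_height.
pose E := [set J : 'I_(3 ^ d) | (3 ^ d <= J + (p.+1 + k))%N]%SET.
apply: (@overlap_matches _ _ _ _ _ _ _ _ fst
  (matches m d 0 k) (matches m d 0 k.+1) (matches m d 1 k) E) => //.
- exact: leq_card_matches.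
- apply: (@leq_card_nat _ _ (fun J : 'I__ => 3 ^ d - J.+1)%N) => [J J' _ _ e|J].
    apply/val_inj => /=.
    by have := congr1 (subn (3 ^ d)) e; rewrite !subKn ?ltn_ord// => -[].
  by rewrite inE subnSK ?ltn_ord// leq_subLR.
- move=> J x xJ xq; rewrite inE.
  have [h|h] := ltnP (start m J + p.+1 + k) (height (m + d)).
    have [J2 J2d xJ2] := (cell_refine d _ pm1).1 xq.
    have e := cell_inj h (start_lt_height J2d pm1) (cell_iter h xJ) xJ2.
    apply/orP; left; apply/imsetP; exists (J, Ordinal J2d) => //.
    by rewrite inE /= addn0; apply/eqP; lia.
  apply/orP; right; rewrite inE -leq_subLR.
  rewrite -start_exp -addnA in h.
  have := leq_trans (start_mono m (ltnW (ltn_ord J))) h.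
  by rewrite leq_add2l; apply: leq_trans; rewrite leq_pmulr// height_gt0.
- exact: matches_fst_inj.
- move=> [J J2] x; rewrite inE /= => /eqP e; apply: (@down J J2 p) => //; lia.
- exact: matches_fst_inj.
- move=> [J J2] x; rewrite inE /= => /eqP e; apply: (@down J J2 p.+2) => //; lia.
Qed.

(** For the inverse, pairs are read from the upper copy down, which exchanges the
    roles of the distances k + 1 and k - 1. *)
Lemma overlap_iter_inv m d p k : (p.+2 < height m)%N -> (0 < k)%N ->
  overlap (iter k (@chacon_inv R)) m p.+1 p.+1 <=
    9 * (overlap (iter k (@chacon_inv R)) m p.+1 p.+2
         + overlap (iter k (@chacon_inv R)) m p.+1 p)
    + (10 * k.+1 + k)%:R * width R (m + d).
Proof.
move=> pm k0; set tau := iter k _; have pm1 := ltnW pm; have pm0 := ltnW pm1.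
have down (J J2 : 'I_(3 ^ d)) q x : (q < height m)%N ->
    (start m J2 + p.+1 = start m J + q + k)%N ->
    cell (m + d) (start m J2 + p.+1) x -> cell m q (tau x).
  move=> qm e xJ; apply/(cell_refine d _ qm); exists J => //.
  by apply: cell_iter_inv; rewrite -?e// start_lt_height.
pose E := [set J : 'I_(3 ^ d) | (J < k)%N]%SET.
apply: (@overlap_matches _ _ _ _ _ _ _ _ snd
  (matches m d 0 k) (matches m d 0 k.+1) (matches m d 1 k) E) => //.
- exact: leq_card_matches.
- apply: (@leq_card_nat _ _ (fun J : 'I__ => nat_of_ord J)) => [J J' _ _|J].
    exact: val_inj.
  by rewrite inE.
- move=> J x xJ xq; rewrite inE; have [h|h] := leqP k (start m J + p.+1).
    have [J2 J2d xJ2] := (cell_refine d _ pm1).1 xq.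
    have lt : (start m J + p.+1 - k < height (m + d))%N.
      by rewrite (leq_ltn_trans (leq_subr _ _))// start_lt_height.
    have xk : cell (m + d) (start m J + p.+1 - k) (tau x).
      by apply: cell_iter_inv; rewrite subnK// start_lt_height.
    have e := cell_inj lt (start_lt_height J2d pm1) xk xJ2.
    apply/orP; left; apply/imsetP; exists (Ordinal J2d, J) => //.
    by rewrite inE /= addn0; apply/eqP; lia.
  apply/orP; right; rewrite inE; apply: leq_ltn_trans h.
  have := start_mono m (leq0n J); rewrite start0 subn0 add0n => le.
  by rewrite (leq_trans _ (leq_trans le (leq_addr _ _)))// leq_pmulr// height_gt0.
- exact: matches_snd_inj.
- move=> [J J2] x; rewrite inE /= => /eqP e; apply: (@down J J2 p.+2) => //; lia.
- exact: matches_snd_inj.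
- move=> [J J2] x; rewrite inE /= => /eqP e; apply: (@down J J2 p) => //; lia.
Qed.

End overlap.

(** * Weak limits *)

Section limit.
Variable R : realType.
Local Notation P := (@chacon_measure R).

Lemma width_small (e : R) : 0 < e ->
  exists N, forall n, (N <= n)%N -> width R n < e.
Proof.
move=> e0; have /cvgr0_norm_lt/(_ e e0) : geometric (2 / 3) (3^-1 : R) @ \oo --> 0.
  by apply: cvg_geometric; rewrite ger0_norm; lra.
move=> [N _ h]; exists N => n /h.
by rewrite /= exprVn ger0_norm// ltW// width_gt0.
Qed.

Lemma le_add_width (a b c : R) m : 0 <= c ->
  (forall d, a <= b + c * width R (m + d)) -> a <= b.
Proof.
move=> c0 h; apply/ler_addgt0Pl => e e0.
have ec : 0 < e / (c + 1) by rewrite divr_gt0//; lra.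
have [N /(_ (m + N)%N (leq_addl _ _)) wN] := width_small ec.
have := h N; rewrite ltr_pdivlMr in wN; last by lra.
by have := width_gt0 R (m + N); lra.
Qed.

(** The previous estimates hold for every d, with an error proportional to the
    width of the levels of Tower m+d. *)
Lemma overlap_neighbours m p k tau : (p.+2 < height m)%N -> (0 < k)%N ->
  tau = iter k (@chacon R) \/ tau = iter k (@chacon_inv R) ->
  overlap tau m p.+1 p.+1 <=
    9 * (overlap tau m p.+1 p + overlap tau m p.+1 p.+2).
Proof.
move=> pm k0 [->|->].
  by apply: le_add_width => [|d]; [|exact: overlap_iter].
by rewrite addrC; apply: le_add_width => [|d]; [|exact: overlap_iter_inv].
Qed.

Lemma iter_koopman (S : R -> R) k (f : R -> R) :
  iter k (koopman S) f = f \o iter k S.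
Proof.
elim: k => // k IH; rewrite iterS IH; apply/funext => x.
by rewrite /koopman /= -iterSr.
Qed.

Definition chacon_pow (k : int) : R -> R :=
  match k with
  | Posz n => iter n (@chacon R)
  | Negz n => iter n.+1 (@chacon_inv R)
  end.

Lemma koopman_pow_chacon k (f : R -> R) :
  koopman_pow (@chacon R) (@chacon_inv R) k f = f \o chacon_pow k.
Proof. by case: k => n; rewrite /koopman_pow iter_koopman. Qed.

Lemma Rintegral_cell m p : (p < height m)%N ->
  \int[P]_x \1_(@cell R m p) x = width R m.
Proof.
move=> pm; rewrite Rintegral_indic; last exact: measurable_cell.
by rewrite [X in fine X]measure_cell.
Qed.

Lemma Rintegral_scale_cell (c : R) m p : (p < height m)%N ->
  \int[P]_x (c * \1_(@cell R m p) x) = c * width R m.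
Proof.
move=> pm; rewrite RintegralZl// ?Rintegral_cell//.
by apply: integrable_indic => //; exact: measurable_cell.
Qed.

Lemma overlap0 m p : (p < height m)%N -> overlap (chacon_pow 0) m p p = width R m.
Proof.
by move=> pm; rewrite overlapE setIid Rintegral_cell.
Qed.

Lemma overlap_cvg (alpha : R) (k : nat -> int) m p q :
  (p < height m)%N -> (q < height m)%N ->
  weak_cvg P (fun j => koopman_pow (@chacon R) (@chacon_inv R) (k j))
    (fun f => alpha \*o Theta P f \+ (1 - alpha) \*o f) ->
  overlap (chacon_pow (k j)) m p q @[j --> \oo] -->
    (alpha * width R m + (1 - alpha) * (p == q)%:R) * width R m.
Proof.
move=> pm qm /(_ \1_(@cell R m q) \1_(@cell R m p)).
have L i : \1_(@cell R m i) \in Lfun P 2%:E.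
  by apply: Lfun_indic; exact: measurable_cell.
move=> /(_ (L q) (L p)).
under eq_fun do rewrite koopman_pow_chacon.
rewrite -(Rintegral_scale_cell _ pm); congr (_ --> _).
congr Rintegral; apply/funext => x /=.
rewrite /Theta /cst Rintegral_cell// !indicE.
have [xp|_] := boolP (x \in cell m p); last by rewrite !mulr0.
congr (_ * _); congr (_ + _ * _); have [<-|pq] := eqVneq p q; first by rewrite xp.
case: (boolP (x \in cell m q)) => // xq; case/eqP: pq.
exact: (cell_inj pm qm (set_mem xp) (set_mem xq)).
Qed.

End limit.

Theorem mainTheorem2 (R : realType) (alpha : R) (alpha01 : 0 < alpha < 1) :
  ~ alpha_weakly_mixing (@chacon_measure R) (@chacon R) (@chacon_inv R) alpha.
Proof.
move=> [k kalpha].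
(* The limits of the two sides of [overlap_neighbours] contradict it when
   (alpha w + 1 - alpha) w > 18 alpha w^2, that is 17 alpha w < 1 - alpha. *)
have e0 : 0 < (1 - alpha) / 17 by lra.
have [N wN] := width_small e0.
have {wN} := wN N.+1 (leqnSn N); set m := N.+1; set w := width R m => w_lt.
have w0 : 0 < w := width_gt0 R m.
have m2 : (2 < height m)%N by have := height_gt0 N; rewrite /=; lia.
have c11 := overlap_cvg (ltnW m2) (ltnW m2) kalpha.
have c10 := overlap_cvg (ltnW m2) (ltnW (ltnW m2)) kalpha.
have c12 := overlap_cvg (ltnW m2) m2 kalpha.
rewrite /= ?eqxx !mulr1 !mulr0 !addr0 -/w in c11 c10 c12.
set L := (_ + _) * w in c11.
have c : overlap (chacon_pow (k j)) m 1 1 - 9 * (overlap (chacon_pow (k j)) m 1 0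
    + overlap (chacon_pow (k j)) m 1 2) @[j --> \oo] -->
    L - 9 * (alpha * w * w + alpha * w * w).
  by apply: cvgB => //; apply: cvgMl_tmp; exact: cvgD.
have L_gt : 0 < L - 9 * (alpha * w * w + alpha * w * w).
  rewrite (_ : _ - _ = (1 - alpha - 17 * (alpha * w)) * w); last by rewrite /L; ring.
  by rewrite mulr_gt0//; nra.
have L_lt : L < w.
  rewrite /L -[ltRHS]mul1r ltr_pM2r//; nra.
have [j [jneighbours jlt]] :=
  filter_ex (filterI (cvgr_gt _ c _ L_gt) (cvgr_lt _ c11 _ L_lt)).
have chacon_pow_neq0 : k j != 0.
  by apply/eqP => kj; move: jlt; rewrite kj overlap0 ?ltxx// ltnW.
have [n n0 tauE] : exists2 n, (0 < n)%N & @chacon_pow R (k j) = iter n (@chacon R)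
    \/ @chacon_pow R (k j) = iter n (@chacon_inv R).
  case: (k j) chacon_pow_neq0 => n; last by exists n.+1; [|right].
  by rewrite -lt0n => n0; exists n => //; left.
have := overlap_neighbours m2 n0 tauE.
by move: jneighbours => /=; lra.
Qed.
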